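(* Let $G$ be a finite group satisfying $o(G)<\frac{31}{12}$, and let $n_2(G)$ be the number of elements of order $2$ in $G$. Then one of the following statements holds: (a) $G$ is a $2$-group with $G'=\Phi(G)$ and $n_2(G)>\frac{17}{24}\,|G|-\frac{3}{2}$; (b) $G\cong C_3$; (c) $G\cong K\rtimes H$ is a Frobenius group whose kernel $K$ is an elementary abelian $3$-group and whose complement $H$ is cyclic of order $2$; moreover, in this case $$o(G)=\frac{5\cdot 3^m-2}{2\cdot 3^m},$$ where $|K|=3^m$.
   Context: For a finite group $G$, $\psi(G)=\sum_{x\in G}o(x)$ denotes the sum of the orders $o(x)$ of the elements $x$ of $G$, and $o(G)=\frac{\psi(G)}{|G|}$ denotes the average order of $G$. $G'$ is the derived (commutator) subgroup of $G$, $\Phi(G)$ is the Frattini subgroup of $G$, and $C_n$ is the cyclic group of order $n$. A $2$-group is a finite group whose order is a power of $2$ (the trivial group, of order $2^0$, is included). *)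

(* Defs.v *)
From mathcomp Require Import all_boot all_order all_algebra.
From mathcomp Require Import all_fingroup all_solvable.

Set Implicit Arguments.
Unset Strict Implicit.
Unset Printing Implicit Defensive.

Definition psi (gT : finGroupType) (G : {set gT}) : nat :=
  (\sum_(x in G) #[x]%g)%N.

Definition avg_order (gT : finGroupType) (G : {set gT}) : rat :=
  ((psi G)%:R / #|G|%:R)%R.

Definition n2 (gT : finGroupType) (G : {set gT}) : nat :=
  #|[set x in G | #[x]%g == 2]|.

(* Main.v *)
Require Import Defs.
From mathcomp Require Import all_boot all_order all_algebra.
From mathcomp Require Import all_fingroup all_solvable.
From mathcomp Require Import zify lra.
Import Order.TTheory GRing.Theory Num.Theory.

(** The hypothesis reads 12 psi(G) < 31 |G|. Element orders are summed coset by
    coset over the cosets g<x> of a subgroup generated by an element x of odd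
    prime order p. Such a coset meets one of three situations.
    - If g inverts x, its elements have order at least 2.
    - If g centralizes x, then the coset contains at most one element of order
      prime to p, and all the others have order divisible by p.
    - Otherwise the coset has at most one element of order 2: two involutions
      of the form gz and gz' would both invert z^-1 z', hence x. The p - 1
      other elements have order at least 3.
    Inverting elements are cheap, but they form a coset of the centralizer C of
    x, so they are never more numerous than the expensive elements of C.

    For p >= 5 this already gives an average of at least 3 - 1/p > 31/12
    ([psi_ge_large_prime]), so |G| = 2^a 3^b. In a 2-group nontrivial elements
    that are not involutions have order at least 4, which yields the bound on
    the involutions; more than half of the elements then lie in Ohm_1(G), so
    G is generated by its involutions, G/G' is elementary abelian, and
    G' = Phi(G) ([Phi_der1_two_group]).

    If 3 divides |G|, choose x of order 3 in the centre of a Sylow 3-subgroup,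
    so that h = |G : C| is prime to 3. The coset inequality
    ([order3_coset_bound]) gives |G| < 4|C| + 24 if x is inverted by some element
    and |G| + 4|C| < 24 otherwise, which leaves |G| = 3, h = 2, h = 4, or h = 8
    with |G| = 24. The last two cases are excluded by giving the elements of
    order 3 the weight 4 instead of 3, once these elements are known to be few
    ([index_cent_order3]).

    If h = 2, elements outside C have even order, and the bound forces nearly
    all of them to be involutions. If |C| > 3, an involution t outside C then
    inverts more than 3/4 of C, so C is abelian and t inverts it; if |C| = 3,
    inverting more than half of C is enough. The average order on C is
    less than 19/6, which excludes elements of order 2 or 9 in C. Hence C is an
    elementary abelian 3-group and G = C ><| <t> is a Frobenius group
    ([centralizer_index2], [frobenius_of_inversion]). *)

Section OrderSums.

Set Implicit Arguments.
Unset Strict Implicit.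

Local Open Scope nat_scope.
Local Open Scope group_scope.

(** * Sums over finite sets and cosets *)

(** The common pattern of the coset estimates: a coset has at most one element of
    exceptionally small order. *)
Lemma sum_ge_but_one (T : finType) (A : {set T}) (f : T -> nat) (a b : nat) :
    A != set0 -> (a <= b)%N -> {in A, forall z, a <= f z}%N ->
    {in A &, forall y z, f y < b -> f z < b -> y = z}%N ->
  (a + b * #|A|.-1 <= \sum_(z in A) f z)%N.
Proof.
move=> /set0Pn[z0 Az0] le_ab ge_a one.
have [z Az cond] : exists2 z, z \in A & {in A, forall y, y != z -> b <= f y}%N.
  case: (boolP [exists z in A, f z < b]%N) => [/exists_inP[z Az fz] | no].
    exists z => // y Ay; apply: contraR; rewrite -ltnNge => fy.
    by apply/eqP/one.
  exists z0 => // y Ay _; rewrite leqNgt; apply: contra no => fy.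
  by apply/exists_inP; exists y.
rewrite (bigD1 z) //= leq_add ?ge_a //.
rewrite (cardsD1 z A) Az /= mulnC -sum_nat_const.
rewrite [X in (_ <= X)%N](eq_bigl (mem (A :\ z))); last first.
  by move=> y; rewrite !inE andbC.
by apply: leq_sum => y /setD1P[yz Ay]; apply: cond.
Qed.

Lemma sum_mem_subset (T : finType) (A B : {set T}) :
  A \subset B -> (\sum_(g in B) (g \in A) = #|A|)%N.
Proof.
move=> /setIidPr AB; rewrite -{2}AB -sum1_card big_mkcond [RHS]big_mkcond.
by apply: eq_bigr => g _; rewrite inE; do 2!case: (_ \in _).
Qed.

Lemma sum_eq1 (gT : finGroupType) (G : {group gT}) :
  (\sum_(g in G) (g == 1%g) = 1)%N.
Proof.
rewrite (bigD1 1%g) //= eqxx big1 ?addn0 // => y /andP[_ /negbTE->] //.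
Qed.

(** Replaces a sum over cosets of <x> by a sum over all g in G of the coset g<x>,
    so that no coset representatives have to be chosen. *)
Lemma sum_translates (gT : finGroupType) (G : {group gT}) (x : gT)
    (F : gT -> nat) :
  x \in G ->
  (\sum_(g in G) \sum_(z in <[x]>) F (g * z)%g = #[x] * \sum_(g in G) F g)%N.
Proof.
move=> Gx; rewrite exchange_big /= -sum_nat_const; apply: eq_bigr => z Xz.
have Gz: z \in G by apply: subsetP Xz; rewrite cycle_subG.
rewrite [RHS](reindex_inj (mulIg z)) /=; apply: eq_bigl => g.
by rewrite groupMr.
Qed.

(** * Elements inverting a given element *)

Definition inverters (gT : finGroupType) (G : {set gT}) (x : gT) :=
  [set g in G | x ^ g == x^-1].

Lemma mem_cent1J (gT : finGroupType) (x g : gT) :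
  (g \in 'C[x]) = (x ^ g == x).
Proof. by rewrite cent1C (sameP cent1P commgP) (sameP conjg_fixP eqP). Qed.

Lemma inverter_notin_cent1 (gT : finGroupType) (G : {set gT}) (x g : gT) :
  (2 < #[x])%N -> g \in inverters G x -> g \notin 'C[x].
Proof.
move=> x_gt2 /setIdP[_ /eqP xg]; rewrite mem_cent1J xg.
apply: contraL x_gt2 => /eqP xV; rewrite -leqNgt.
by apply: dvdn_leq => //; rewrite order_dvdn expgS expg1 -{1}xV mulVg.
Qed.

(** If t inverts x, then g inverts x exactly when g t^-1 centralizes x. *)
Lemma inverters_rcoset (gT : finGroupType) (G : {group gT}) (x t : gT) :
  t \in inverters G x -> inverters G x = 'C_G[x] :* t.
Proof.
rewrite inE => /andP[Gt /eqP xt]; apply/setP=> g.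
rewrite mem_rcoset inE [in RHS]inE mem_cent1J groupMr ?groupV //.
by rewrite conjgM -[in RHS](inj_eq (conjg_inj t)) conjgKV xt.
Qed.

Lemma card_inverters (gT : finGroupType) (G : {group gT}) (x : gT) :
  #|inverters G x| = 0 \/ #|inverters G x| = #|'C_G[x]|.
Proof.
have [->|[t It]] := set_0Vmem (inverters G x); first by left; rewrite cards0.
by right; rewrite (inverters_rcoset It) card_rcoset.
Qed.

Lemma conjg_of_involutions (gT : finGroupType) (u y : gT) :
  u * u = 1 -> u * y * (u * y) = 1 -> y ^ u = y^-1.
Proof.
move=> uu uyuy; have uV: u^-1 = u by apply/eqP; rewrite eq_invg_mul uu.
apply/eqP; rewrite eq_sym eq_invg_mul; apply/eqP.
have -> : y * y ^ u = (u * y * (u * y)) ^ u.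
  by rewrite !conjgE {1}uV -!mulgA mulKg.
by rewrite uyuy conj1g.
Qed.

(** With u = gz and y = z^-1 z', both u and uy square to 1, so u inverts y.
    If y is not 1 it generates <x>, so u inverts x, and so does g, which differs
    from u by an element commuting with x. *)
Lemma inverter_of_two_involutions (gT : finGroupType) (x g z z' : gT) :
    prime #[x] -> z \in <[x]> -> z' \in <[x]> -> x ^ g != x^-1 ->
    (#[g * z] < 3)%N -> (#[g * z'] < 3)%N -> z = z'.
Proof.
move=> pr_x Xz Xz' not_inv oz oz'.
have sq (u : gT) : (#[u] < 3)%N -> u * u = 1.
  move=> ou; apply/eqP; rewrite -[u * u]/(u ^+ 2) -order_dvdn.
  by move: (order_gt0 u) ou; case: #[u] => [|[|[|]]].
apply/eqP; apply: contraR not_inv => zz'.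
set u := g * z in oz; set y := z^-1 * z'.
have Xy: y \in <[x]> by rewrite groupM ?groupV.
have y1: y != 1 by rewrite /y -eq_mulVg1.
have uy: g * z' = u * y by rewrite /u /y mulgA mulgK.
have yu: y ^ u = y^-1.
  by apply: conjg_of_involutions; rewrite -?uy sq.
have Xxy: x \in <[y]>.
  have /= := prime_meetG (G := <[x]>) (H := <[y]>) pr_x.
  by move=> P; rewrite -cycle_subG P //; apply/trivgPn; exists y;
    rewrite // inE Xy cycle_id.
have xu: x ^ u = x^-1 by case/cycleP: Xxy => k ->; rewrite conjXg yu expgVn.
have cxz: commute x z by case/cycleP: Xz => k ->; apply: commuteX.
rewrite -(inj_eq (conjg_inj z)) -conjgM xu conjVg.
by rewrite (conjg_fixP _) ?eqxx //; apply/commgP.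
Qed.

Lemma cycle3_nontrivial (gT : finGroupType) (x y : gT) :
  #[x] = 3 -> y \in <[x]> -> #[y] = 3 -> y == x \/ y == x^-1.
Proof.
move=> ox /cyclePmin[k]; rewrite ox; case: k => [|[|[|k]]] // _ ->.
- by rewrite expg0 order1.
- by left; rewrite expg1.
right; rewrite eq_sym eq_invg_mul -expgS -ox expg_order //.
Qed.

(** An element normalizing <x> maps x to x or to x^-1, so the normaliser is the
    disjoint union of the centralizer and the coset of inverting elements. *)
Lemma card_inverters_normaliser (gT : finGroupType) (G : {group gT}) (x : gT) :
    x \in G -> #[x] = 3 -> inverters G x != set0 ->
  #|'N_G(<[x]>)| = (2 * #|'C_G[x]|)%N.
Proof.
move=> Gx ox I0.
have -> : 'N_G(<[x]>) = 'C_G[x] :|: inverters G x.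
  apply/setP=> g; rewrite in_setU !in_setI [_ \in inverters _ _]inE mem_cent1J.
  rewrite -andb_orr; case: (g \in G) => //=.
  rewrite inE -cycleJ cycle_subG; apply/idP/orP=> [Xg|[]/eqP->]; last 2 first.
  - exact: cycle_id.
  - by rewrite groupV cycle_id.
  exact: cycle3_nontrivial ox Xg (etrans (orderJ x g) ox).
rewrite cardsU; have -> : 'C_G[x] :&: inverters G x = set0.
  apply/setP=> g; rewrite [RHS]inE; apply/negP=> /setIP[/setIP[_ cgx]].
  by move/(inverter_notin_cent1 (G := G)); rewrite ox cgx => /(_ isT).
rewrite cards0; have [c0|->] := card_inverters G x; last by lia.
by move: I0; rewrite -card_gt0 c0.
Qed.

(** * Weighted order sums over the cosets of a cyclic subgroup *)

(** The order itself for e = 0. For e = 1 elements of order 3 count as if they had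
    order 4: this sharpens the estimate when they are known to be few. *)
Definition weight (gT : finGroupType) (e : nat) (g : gT) : nat :=
  (#[g] + e * (#[g] == 3))%N.

Lemma sum_weight (gT : finGroupType) (G : {group gT}) (e : nat) :
  (\sum_(g in G) weight e g = psi G + e * #|[set g in G | #[g] == 3]|)%N.
Proof.
rewrite big_split -big_distrr /= -sum1dep_card big_mkcondr /=.
by congr (_ + _ * _)%N; apply: eq_bigr => g _; case: eqP.
Qed.

Lemma weight_gt0 (gT : finGroupType) (e : nat) (g : gT) : (0 < weight e g)%N.
Proof. by rewrite addn_gt0 order_gt0. Qed.

Lemma weight_gt1 (gT : finGroupType) (e : nat) (g : gT) :
  g != 1 -> (1 < weight e g)%N.
Proof. by rewrite -order_gt1 /weight => /leq_trans-> //; apply: leq_addr. Qed.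

Lemma weight_ge (gT : finGroupType) (e : nat) (g : gT) :
  (e <= 1 -> 2 < #[g] -> 3 + e <= weight e g)%N.
Proof. by rewrite /weight; case: eqP; lia. Qed.

Lemma mulg_cycle_neq1 (gT : finGroupType) (x g z : gT) :
  z \in <[x]> -> g \notin <[x]> -> g * z != 1.
Proof.
move=> Xz; apply: contra => /eqP gz1.
by rewrite -(groupMr g Xz) gz1 group1.
Qed.

Lemma sub_cycle_cent1 (gT : finGroupType) (G : {group gT}) (x : gT) :
  x \in G -> <[x]> \subset 'C_G[x].
Proof. by move=> Gx; rewrite cycle_subG inE Gx cent1id. Qed.

(** Here at most one element of the coset has order below 3, by
    [inverter_of_two_involutions]; none is trivial as g is outside <x>. *)
Lemma coset_weight_generic (gT : finGroupType) (G : {group gT}) (x g : gT) e :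
    (e <= 1)%N -> x \in G -> prime #[x] -> g \in G ->
    g \notin 'C_G[x] -> g \notin inverters G x ->
  (2 + (3 + e) * #[x].-1 <= \sum_(z in <[x]>) weight e (g * z))%N.
Proof.
move=> e1 Gx pr_x Gg ncg; rewrite inE Gg /= => nig.
have nXg: g \notin <[x]> by apply: contra ncg; apply/subsetP/sub_cycle_cent1.
have X0: <[x]> != set0 by apply/set0Pn; exists 1.
apply: sum_ge_but_one => // [z Xz|y z Xy Xz ly lz].
  exact: weight_gt1 (mulg_cycle_neq1 Xz nXg).
have small u : (weight e u < 3 + e -> #[u] < 3)%N.
  by move=> ou; rewrite ltnNge; apply/negP=> /(weight_ge e1); lia.
by apply: (inverter_of_two_involutions pr_x Xy Xz nig); apply: small.
Qed.

Lemma coset_weight_inverter (gT : finGroupType) (G : {group gT}) (x g : gT) e :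
    (2 < #[x])%N -> g \in inverters G x ->
  (2 * #[x] <= \sum_(z in <[x]>) weight e (g * z))%N.
Proof.
move=> x_gt2 Ig; have nXg: g \notin <[x]>.
  apply: contra (inverter_notin_cent1 x_gt2 Ig).
  by apply/subsetP; rewrite cycle_subG cent1id.
rewrite mulnC -sum_nat_const; apply: leq_sum => z Xz.
exact: weight_gt1 (mulg_cycle_neq1 Xz nXg).
Qed.

(** The quotient y^-1 z has order p = #[x] and commutes with g y, so the orders
    multiply when they are coprime. *)
Lemma order_coset_cent (gT : finGroupType) (x g y z : gT) :
    prime #[x] -> g \in 'C[x] -> y \in <[x]> -> z \in <[x]> -> y != z ->
    coprime #[g * y] #[x] -> #[g * z] = (#[g * y] * #[x])%N.
Proof.
move=> pr_x cgx Xy Xz yz co; set w := y^-1 * z.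
have Xw: w \in <[x]> by rewrite groupM ?groupV.
have w1: w != 1 by rewrite -eq_mulVg1.
have ow: #[w] = #[x].
  have /primeP[_ /(_ #[w])] := pr_x.
  by move=> /(_ (order_dvdG Xw)); rewrite order_eq1 (negbTE w1) => /eqP.
have -> : g * z = (g * y) * w by rewrite /w mulgA mulgK.
have cXx : <[x]> \subset 'C[x] by rewrite cycle_subG cent1id.
have cgy: commute (g * y) w.
  have : g * y \in 'C[x] by rewrite groupM // (subsetP cXx).
  by move/cent1P=> cxg; case/cycleP: Xw => k ->; apply/commuteX/commute_sym.
by rewrite orderM // ?ow.
Qed.

(** An element of order less than 5 has order prime to p, so by [order_coset_cent]
    every other element of its coset has order at least p. *)
Lemma coset_order_cent (gT : finGroupType) (x g : gT) :
    prime #[x] -> (4 < #[x])%N -> g \in 'C[x] ->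
  (1 + 5 * #[x].-1 <= \sum_(z in <[x]>) #[(g * z)%g])%N.
Proof.
move=> pr_x x_gt4 cgx.
have X0: <[x]> != set0 by apply/set0Pn; exists 1.
apply: sum_ge_but_one => // y z Xy Xz ly lz.
apply/eqP; apply: contraLR lz => yz; rewrite -leqNgt.
rewrite (order_coset_cent pr_x cgx Xy Xz yz).
  by rewrite (leq_trans x_gt4) // leq_pmull ?order_gt0.
rewrite coprime_sym prime_coprime //; apply/negP=> /dvdn_leq.
by rewrite order_gt0 => /(_ isT); lia.
Qed.

(** Outside <x>, a coset containing an involution u has orders 2, 6, 6, and any
    other coset has only orders at least 3. The coset <x> itself has orders
    1, 3, 3, which the correction term makes up for. *)
Lemma coset_weight_cent3 (gT : finGroupType) (x g : gT) e :
    (e <= 1)%N -> #[x] = 3 -> g \in 'C[x] ->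
  (9 + 3 * e <= \sum_(z in <[x]>) weight e (g * z)%g
                + (2 + e) * (g \in <[x]>))%N.
Proof.
move=> e1 ox cgx; case: (boolP (g \in <[x]>)) => Xg.
  have X0: <[x]> != set0 by apply/set0Pn; exists 1.
  have : (1 + (3 + e) * #[x].-1 <= \sum_(z in <[x]>) weight e (g * z)%g)%N.
    apply: sum_ge_but_one => // [z Xz|y z Xy Xz ly lz].
      exact: weight_gt0.
    have one u : u \in <[x]> -> (weight e u < 3 + e)%N -> u = 1.
      move=> Xu; have := order_dvdG Xu; rewrite -[#|<[x]>|]/#[x] ox.
      move=> du lu; apply/eqP; rewrite -order_eq1.
      have /primeP[_ /(_ _ du)/orP[//|/eqP o3]] := isT : prime 3.
      by move: lu; rewrite /weight o3 eqxx; lia.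
    have y1 := one _ (groupM Xg Xy) ly; have z1 := one _ (groupM Xg Xz) lz.
    by apply: (mulgI g); rewrite y1 z1.
  by rewrite ox; lia.
rewrite muln0 addn0.
have pr_x: prime #[x] by rewrite ox.
have X0: <[x]> != set0 by apply/set0Pn; exists 1.
case: (boolP [exists z in <[x]>, #[g * z] == 2]) => [/exists_inP[z Xz /eqP o2]|no].
  have o6 y : y \in <[x]> -> (weight e (g * y) < 6)%N -> y = z.
    move=> Xy ly; apply/eqP; apply: contraLR ly; rewrite eq_sym -leqNgt => yz.
    by rewrite /weight (order_coset_cent pr_x cgx Xz Xy yz) o2 ox.
  have : (2 + 6 * #[x].-1 <= \sum_(z in <[x]>) weight e (g * z)%g)%N.
    apply: sum_ge_but_one => // [y Xy|y1 y2 Xy1 Xy2 l1 l2].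
      exact: weight_gt1 (mulg_cycle_neq1 Xy Xg).
    by rewrite (o6 y1 Xy1 l1) (o6 y2 Xy2 l2).
  by rewrite ox; lia.
have : (\sum_(z in <[x]>) (3 + e) <= \sum_(z in <[x]>) weight e (g * z)%g)%N.
  apply: leq_sum => z Xz; apply: weight_ge => //.
  have := mulg_cycle_neq1 Xz Xg; rewrite -order_gt1 => g1.
  rewrite ltn_neqAle g1 andbT eq_sym; apply: contra no => o2.
  by apply/exists_inP; exists z.
by rewrite sum_nat_const -[#|<[x]>|]/#[x] ox; lia.
Qed.

(** * The coset inequalities *)

(** The cosets of elements centralizing x exceed the bound 3p - 1 by p + 1 at
    least, while those of inverting elements fall short of it by p - 1 at most;
    the latter are not more numerous than the former. *)
Lemma psi_ge_large_prime (gT : finGroupType) (G : {group gT}) (x : gT) :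
    x \in G -> prime #[x] -> (4 < #[x])%N ->
  ((3 * #[x] - 1) * #|G| <= #[x] * psi G)%N.
Proof.
move=> Gx pr_x x4.
have pt g : g \in G ->
    ((3 * #[x] - 1) + (#[x] + 1) * (g \in 'C_G[x]) <=
     \sum_(z in <[x]>) #[(g * z)%g] + (#[x] - 1) * (g \in inverters G x))%N.
  move=> Gg.
  have w0 : (\sum_(z in <[x]>) #[(g * z)%g] =
             \sum_(z in <[x]>) weight 0 (g * z)%g)%N.
    by apply: eq_bigr => z _; rewrite /weight addn0.
  case: (boolP (g \in 'C_G[x])) => [/setIP[_ cgx]|ncgx].
    apply: leq_trans (leq_addr _ _).
    have := coset_order_cent pr_x x4 cgx; rewrite muln1.
    by move: #[x] x4 (\sum_(z in _) _)%N => *; lia.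
  case: (boolP (g \in inverters G x)) => [igx|nigx]; rewrite w0.
    have := coset_weight_inverter 0 (ltnW (ltnW x4)) igx.
    rewrite muln0 muln1.
    by move: #[x] x4 (\sum_(z in _) _)%N => *; lia.
  have := coset_weight_generic (leqnSn 0) Gx pr_x Gg ncgx nigx.
  rewrite !muln0.
  by move: #[x] x4 (\sum_(z in _) _)%N => *; lia.
have := leq_sum (index_enum gT) pt.
rewrite !big_split /= -!big_distrr /= sum_nat_const.
rewrite (sum_translates (fun g => #[g]) Gx).
rewrite !sum_mem_subset ?subsetIl //; last by apply/subsetP=> g /setIdP[].
rewrite -/(psi G); have : (#|inverters G x| <= #|'C_G[x]|)%N.
  by case: (card_inverters G x) => ->.
by move: (psi G) #|inverters G x| #|'C_G[x]| #|G| => *; nia.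
Qed.

(** Sum of the pointwise bounds on the cosets g<x>, compared with the generic value
    8 + 2e: centralizing elements gain 1 + e, inverting elements lose 2 + 2e,
    and the three elements of <x> lose 2 + e each. *)
Lemma order3_coset_bound (gT : finGroupType) (G : {group gT}) (x : gT) e :
    (e <= 1)%N -> x \in G -> #[x] = 3 ->
  ((8 + 2 * e) * #|G| + (1 + e) * #|'C_G[x]| <=
   3 * (psi G + e * #|[set g in G | #[g] == 3]|)
   + (2 + 2 * e) * #|inverters G x| + (6 + 3 * e))%N.
Proof.
move=> e1 Gx ox; have pr_x: prime #[x] by rewrite ox.
have pt g : g \in G ->
    ((8 + 2 * e) + (1 + e) * (g \in 'C_G[x]) <=
     (\sum_(z in <[x]>) weight e (g * z)%g
      + (2 + 2 * e) * (g \in inverters G x))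
     + (2 + e) * (g \in <[x]>))%N.
  move=> Gg.
  case: (boolP (g \in 'C_G[x])) => [/setIP[_ cgx]|ncgx].
    have := coset_weight_cent3 e1 ox cgx; rewrite muln1.
    move: (\sum_(z in _) _)%N ((2 + e) * _)%N ((2 + 2 * e) * _)%N => S a b.
    by lia.
  case: (boolP (g \in inverters G x)) => [igx|nigx].
    have x2: (2 < #[x])%N by rewrite ox.
    have := coset_weight_inverter e x2 igx; rewrite ox muln0 muln1.
    by move: (\sum_(z in _) _)%N ((2 + e) * _)%N => S a; lia.
  have := coset_weight_generic e1 Gx pr_x Gg ncgx nigx; rewrite ox !muln0.
  by move: (\sum_(z in _) _)%N ((2 + e) * _)%N => S a; lia.
have := leq_sum (index_enum gT) pt.
rewrite !big_split /= -!big_distrr /= sum_nat_const.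
rewrite (sum_translates (weight e) Gx) sum_weight ox.
rewrite !sum_mem_subset ?subsetIl ?cycle_subG //; last by apply/subsetP=> g /setIdP[].
rewrite -[#|<[x]>|]/#[x] ox.
rewrite !sum_nat_const; move: (psi G) #|G| #|'C_G[x]| #|inverters G x|.
by move: #|[set g in G | _]| => *; lia.
Qed.

(** A prime p >= 5 would give 12 (3p - 1) < 31 p, that is 5p < 12. *)
Lemma pi_le3_of_small_psi (gT : finGroupType) (G : {group gT}) :
  (12 * psi G < 31 * #|G|)%N -> {in \pi(G), forall p, p <= 3}%N.
Proof.
move=> small p; rewrite mem_primes => /and3P[pr_p _ dp].
have [x Gx ox] := Cauchy pr_p dp.
rewrite leqNgt; apply/negP=> p3.
have p5: (4 < #[x])%N by rewrite ox; case: p pr_p p3 {dp ox} => [|[|[|[|[|p]]]]].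
have := psi_ge_large_prime Gx _ p5; rewrite ox => /(_ pr_p).
rewrite ox in p5; move: (psi G) #|G| small => s n small.
by nia.
Qed.

(** This is [order3_coset_bound] inside the centralizer of x, where nothing inverts
    x. Equality holds when all nontrivial elements have order 3. *)
Lemma psi_centralizer_order3 (gT : finGroupType) (G : {group gT}) (x : gT) :
  x \in G -> #[x] = 3 -> (3 * #|'C_G[x]| <= psi 'C_G[x] + 2)%N.
Proof.
move=> Gx ox; have Cx: x \in 'C_G[x] by rewrite inE Gx cent1id.
have := order3_coset_bound (leq0n 1) Cx ox.
have -> : 'C_('C_G[x])[x] = 'C_G[x] by rewrite -setIA setIid.
have -> : inverters 'C_G[x] x = set0.
  apply/setP=> g; rewrite [RHS]inE; apply/negP=> Ig.
  have /setIdP[/setIP[_ cgx] _] := Ig.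
  by have := inverter_notin_cent1 _ Ig; rewrite ox cgx => /(_ isT).
by rewrite cards0; move: (psi _) #|'C_G[x]| => *; lia.
Qed.

(** * Large subsets of groups *)

Lemma proper_subgroup_half (gT : finGroupType) (H K : {group gT}) :
  H \proper K -> (2 * #|H| <= #|K|)%N.
Proof.
move=> /andP[sHK nsKH]; rewrite -(Lagrange sHK) mulnC leq_pmul2l //.
by rewrite ltnNge; apply: contra nsKH => i1; rewrite -indexg_eq1 eqn_leq i1 /=.
Qed.

Lemma subgroup_more_than_half (gT : finGroupType) (H K : {group gT}) :
  H \subset K -> (#|K| < 2 * #|H|)%N -> H = K :> {set gT}.
Proof.
move=> sHK ltKH; apply/eqP; rewrite eqEproper sHK /=.
by apply: contraL ltKH => /proper_subgroup_half; rewrite -leqNgt.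
Qed.

Lemma odd_order_index2 (gT : finGroupType) (G H : {group gT}) (g : gT) :
  H \subset G -> #|G : H| = 2 -> g \in G -> odd #[g] -> g \in H.
Proof.
move=> sHG iH Gg og; have nHG := index2_normal sHG iH.
have nHg: g \in 'N(H) by apply: subsetP Gg; apply: normal_norm.
apply: coset_idr => //; apply/eqP; rewrite -order_eq1 -dvdn1.
have <-: gcdn 2 #[g] = 1%N by apply/eqP; rewrite -[_ == _]/(coprime 2 _) coprime2n.
rewrite dvdn_gcd morph_order // andbT -iH -card_quotient ?normal_norm //.
by apply: order_dvdG; apply: mem_quotient.
Qed.

(** If s and sy as well as y are inverted by t, then s and y commute. For each
    inverted s the set of such y has more than |K|/2 elements, so s is central;
    hence the centre contains more than 3/4 of K. *)
Lemma abelian_of_many_inverted (gT : finGroupType) (K : {group gT}) (t : gT) :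
  (3 * #|K| < 4 * #|[set y in K | (y ^ t == y^-1)%g]|)%N -> abelian K.
Proof.
set S := [set y in K | _] => big.
have sSK: S \subset K by apply/subsetP=> y /setIdP[].
have sSZ: S \subset 'Z(K).
  apply/subsetP=> s Ss; have Ks := subsetP sSK s Ss.
  have cS: S :&: s^-1 *: S \subset 'C_K[s].
    apply/subsetP=> y /setIP[Sy]; rewrite mem_lcoset invgK inE => /andP[_].
    move: Ss Sy; rewrite inE => /andP[_ /eqP st] /setIdP[Ky /eqP yt].
    rewrite conjMg st yt invMg => /eqP csy; rewrite inE Ky; apply/cent1P.
    by apply/eqP; rewrite -(inj_eq invg_inj) !invMg csy.
  have cK: 'C_K[s] = K.
    apply: subgroup_more_than_half; rewrite ?subsetIl //.
    have sUK : S :|: s^-1 *: S \subset K.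
      rewrite subUset sSK.
      by apply: subset_trans (mulgS _ sSK) _; rewrite mul_subG ?sub1set ?groupV.
    have := cardsUI S (s^-1 *: S); rewrite card_lcoset.
    have := subset_leq_card cS; have := subset_leq_card sUK; move: big.
    move: #|S :|: _| #|S :&: _| #|'C_K[s]| #|S| #|K| => *; lia.
  by rewrite inE Ks /= -sub_cent1 -cK subsetIr.
have ZK: 'Z(K) = K.
  apply: subgroup_more_than_half; rewrite ?subsetIl //.
  have := subset_leq_card sSZ; move: big; move: #|S| #|'Z(K)| #|K| => *; lia.
by rewrite -ZK center_abelian.
Qed.

(** In an abelian group the inverted elements form a subgroup. *)
Lemma inverted_of_many_inverted (gT : finGroupType) (K : {group gT}) (t : gT) :
    abelian K -> (#|K| < 2 * #|[set y in K | (y ^ t == y^-1)%g]|)%N ->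
  {in K, forall y, y ^ t = y^-1}.
Proof.
set S := [set y in K | _] => abK big.
have gS: group_set S.
  apply/group_setP; split; first by rewrite inE group1 conj1g invg1 /=.
  move=> y z /setIdP[Ky /eqP yt] /setIdP[Kz /eqP zt].
  by rewrite inE groupM //= conjMg yt zt -invMg (centsP abK y).
have sSK: Group gS \subset K by apply/subsetP=> y /setIdP[].
have SK: Group gS = K :> {set gT} by apply: subgroup_more_than_half.
by move=> y; rewrite -SK inE => /andP[_ /eqP].
Qed.

(** * Order sums of abelian groups *)

Lemma psi_setD (gT : finGroupType) (G H : {group gT}) :
  H \subset G -> (psi G = psi H + \sum_(g in G :\: H) #[g])%N.
Proof.
by move=> sHG; rewrite /psi (big_setID H) /= (setIidPr sHG).
Qed.

Lemma psi_abelem3 (gT : finGroupType) (K : {group gT}) :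
  3.-abelem K -> (psi K + 2 = 3 * #|K|)%N.
Proof.
move=> abK; have pt y : y \in K -> (#[y] + (y == 1%g) * 2 = 3)%N.
  move=> Ky; have [->|y1] := eqVneq y 1; first by rewrite order1.
  by rewrite (abelem_order_p abK).
have : (\sum_(y in K) (#[y] + (y == 1%g) * 2) = \sum_(y in K) 3)%N.
  exact: eq_bigr pt.
rewrite big_split -big_distrl /= sum_eq1 sum_nat_const.
by rewrite -/(psi K); move: (psi K) #|K| => *; lia.
Qed.

(** Ohm_1(K) is a proper subgroup, so at least half of the elements have order 9
    or more. *)
Lemma psi_not_abelem3 (gT : finGroupType) (K : {group gT}) :
  abelian K -> 3.-group K -> ~~ 3.-abelem K -> (6 * #|K| <= psi K + 2)%N.
Proof.
move=> abK p3K; rewrite (sameP (abelem_Ohm1P abK p3K) eqP) => nOhm.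
have sOK := Ohm_sub 1 K.
have half : (2 * #|'Ohm_1(K)| <= #|K|)%N.
  by apply: proper_subgroup_half; rewrite properEneq nOhm.
have memO y : y \in K -> (y \in 'Ohm_1(K)) = (#[y] %| 3).
  move=> Ky; rewrite (OhmEabelian p3K) ?(abelianS sOK) //.
  by rewrite !inE Ky order_dvdn.
have pt y : y \in K ->
    (9 <= #[y] + (y \in 'Ohm_1(K)) * 6 + (y == 1%g) * 2)%N.
  move=> Ky; have [->|y1] := eqVneq y 1; first by rewrite group1 order1.
  rewrite memO //; have := p_natP (mem_p_elt p3K Ky) => -[k ok].
  move: y1; rewrite -order_eq1 ok; case: k {ok} => [|[|k]] // _.
  by rewrite !expnS; have := expn_gt0 3 k; lia.
have := leq_sum (index_enum gT) pt.
rewrite !big_split -!big_distrl /= sum_eq1 sum_mem_subset // sum_nat_const.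
by rewrite -/(psi K); move: (psi K) #|K| #|'Ohm_1(K)| half => *; lia.
Qed.

(** Write K = A x B with A the 2-part, a = |A| >= 2 and b = |B| >= 3. Orders are at
    least 2 on A, at least 3 on B and at least 6 elsewhere, except for the
    identity, which gives psi(K) >= (2a - 1)(3b - 2) >= 7ab/2. *)
Lemma psi_abelian_even (gT : finGroupType) (K : {group gT}) :
  abelian K -> 2 %| #|K| -> 3 %| #|K| -> (7 * #|K| <= 2 * psi K)%N.
Proof.
move=> abK d2 d3; have nilK := abelian_nil abK.
have /dprod_card := nilpotent_pcoreC 2 nilK.
set A := 'O_2(K); set B := 'O_2^'(K) => cAB.
have memA y : y \in K -> (y \in A) = 2.-elt y.
  exact: mem_normal_Hall (nilpotent_pcore_Hall 2 nilK) (pcore_normal _ _).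
have memB y : y \in K -> (y \in B) = 2^'.-elt y.
  exact: mem_normal_Hall (nilpotent_pcore_Hall 2^' nilK) (pcore_normal _ _).
have pA: 2.-nat #|A| := pcore_pgroup 2 K.
have pB: 2^'.-nat #|B| := pcore_pgroup 2^' K.
have a2: (2 <= #|A|)%N.
  move: d2; rewrite -cAB Euclid_dvdM // => /orP[/dvdn_leq->//|].
  by move: pB; rewrite p'natE // => /negP.
have b3: (3 <= #|B|)%N.
  move: d3; rewrite -cAB Euclid_dvdM // => /orP[d3|/dvdn_leq->//].
  by have /(_ 3) := pnatP 2 (cardG_gt0 _) pA; move/(_ isT d3).
have pt y : y \in K ->
    (6 + (y == 1%g) * 2 <= #[y] + (y \in B) * 3 + (y \in A) * 4)%N.
  move=> Ky; have [->|y1] := eqVneq y 1; first by rewrite !group1 order1.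
  have o2: (1 < #[y])%N by rewrite order_gt1.
  have [_|nAy] := boolP (y \in A); first by lia.
  have oddP n : 2^'.-nat n -> (n != 1 -> 3 <= n)%N.
    by rewrite -odd_2'nat; case: n => [|[|[|n]]].
  have [By|nBy] := boolP (y \in B).
    have o3 : (3 <= #[y])%N by rewrite oddP ?order_eq1 -?[_.-nat _]memB.
    by lia.
  rewrite !addn0 -(partnC 2 (order_gt0 y)).
  have e2: (2 <= #[y]`_2)%N.
    by rewrite ltn_neqAle part_gt0 andbT eq_sym partn_eq1 -?[_.-nat _]memB
       ?order_gt0.
  have e3: (3 <= #[y]`_2^')%N.
    rewrite oddP ?part_pnat // partn_eq1 //; apply: contra nAy.
    by rewrite memA // /p_elt (eq_pnat _ (negnK 2)).
  exact: leq_mul e2 e3.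
have := leq_sum (index_enum gT) pt.
rewrite !big_split -!big_distrl /= sum_nat_const -/(psi K).
rewrite !sum_mem_subset ?pcore_sub //.
have -> : (\sum_(i in K) (i == 1%g) = 1)%N.
  rewrite (bigD1 1%g) //= eqxx big1 ?addn0 // => y /andP[_ /negbTE->] //.
rewrite -cAB; move: #|A| #|B| a2 b3 (psi K) => a c; clear; nia.
Qed.

(** * A centralizer of index two *)

(** Elements outside C = 'C_G[x] have even order, so order 2 or at least 4. As
    psi(C) >= 3|C| - 2, the hypothesis gives more than 11|C|/12 - 1 involutions
    outside C. If t is one of them, the others are the t y with y in C inverted
    by t, so t inverts almost all of C. *)
Lemma centralizer_index2 (gT : finGroupType) (G : {group gT}) (x : gT) :
    {in \pi(G), forall p, p <= 3}%N -> x \in G -> #[x] = 3 ->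
    #|G : 'C_G[x]| = 2 -> (12 * psi G < 31 * #|G|)%N ->
  exists t, [/\ t \in G :\: 'C_G[x], #[t] = 2, 3.-abelem 'C_G[x],
    {in 'C_G[x], forall y, y ^ t = y^-1}
    & (psi G + 2 = 5 * #|'C_G[x]|)%N].
Proof.
move=> pi23 Gx ox iC small; set C := 'C_G[x].
have sCG: C \subset G by apply: subsetIl.
have nCG: C <| G := index2_normal sCG iC.
have oG: (#|G| = 2 * #|C|)%N by rewrite -(Lagrange sCG) iC mulnC.
have oD: #|G :\: C| = #|C| by have := cardsID C G; rewrite (setIidPr sCG); lia.
have evD g : g \in G :\: C -> ~~ odd #[g].
  case/setDP=> Gg; by apply: contra => /(odd_order_index2 sCG iC Gg).
have d3C: 3 %| #|C| by rewrite -ox order_dvdG // inE Gx cent1id.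
have c3: (3 <= #|C|)%N by apply: dvdn_leq.
pose J := [set g in G :\: C | #[g] == 2].
have bigJ: (11 * #|C| < 12 * #|J| + 12)%N.
  have pt g : g \in G :\: C -> (4 <= #[g] + (g \in J) * 2)%N.
    move=> Dg; rewrite inE Dg /=; have := evD g Dg; have := order_gt0 g.
    by case: #[g] => [|[|[|[|n]]]].
  have := leq_sum (index_enum gT) pt.
  rewrite big_split -big_distrl /= sum_nat_const oD sum_mem_subset; last first.
    by apply/subsetP=> g /setIdP[].
  move: small; rewrite oG (psi_setD sCG).
  have := psi_centralizer_order3 Gx ox; rewrite -/C.
  by move: (psi C) (\sum_(g in _) _)%N #|J| #|C| => *; lia.
have [J0|[t Jt]] := set_0Vmem J.
  by move: bigJ; rewrite J0 cards0; move: #|C| c3 => *; lia.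
have [Dt /eqP ot] := setIdP Jt; have [Gt nCt] := setDP Dt.
have tt: t * t = 1 by rewrite -[t * t]/(t ^+ 2) -ot expg_order.
have DE : G :\: C = t *: C.
  apply/eqP; rewrite eq_sym eqEcard card_lcoset oD leqnn andbT.
  apply/subsetP=> _ /lcosetP[y Cy ->].
  by rewrite inE groupMr // nCt groupM // (subsetP sCG).
set S := [set y in C | (y ^ t == y^-1)%g].
have JS: J \subset t *: S.
  apply/subsetP=> g /setIdP[]; rewrite DE => /lcosetP[y Cy ->] /eqP oty.
  rewrite mem_lcoset mulKg inE Cy.
  rewrite (conjg_of_involutions tt) ?eqxx ?andbT //.
  by have := expg_order (t * y); rewrite oty expgS expg1.
have leJS: (#|J| <= #|S|)%N.
  by have := subset_leq_card JS; rewrite card_lcoset.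
have abC: abelian C.
  (* 11c/12 - 1 >= 3c/4 as soon as c >= 6; a smaller multiple of 3 is 3. *)
  have [c6|c6] := leqP 6 #|C|.
    apply: (@abelian_of_many_inverted _ _ t); rewrite -/S.
    by move: #|J| #|S| #|C| bigJ leJS c6 => *; lia.
  suff c3': #|C| = 3 by apply/cyclic_abelian/prime_cyclic; rewrite c3'.
  by case: #|C| c3 c6 d3C => [|[|[|[|[|[|]]]]]].
have invC: {in C, forall y, y ^ t = y^-1}.
  apply: inverted_of_many_inverted => //; rewrite -/S.
  by move: #|J| #|S| #|C| bigJ leJS c3 => *; lia.
have D2 g : g \in G :\: C -> #[g] = 2.
  move=> Dg; have [_ nCg] := setDP Dg; apply: nt_prime_order => //.
    move: Dg; rewrite DE => /lcosetP[y Cy ->]; have := invC y Cy.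
    have tV: t^-1 = t by apply/eqP; rewrite eq_invg_mul tt.
    by rewrite conjgE tV expgS expg1 !mulgA => ->; rewrite mulVg.
  by apply: contraNneq nCg => ->.
have psiG: (psi G = psi C + 2 * #|C|)%N.
  by rewrite (psi_setD sCG) (eq_bigr _ D2) sum_nat_const oD mulnC.
(* 31/12 on G leaves 31/6 - 2 = 19/6 on C. *)
have smallC: (6 * psi C < 19 * #|C|)%N.
  by move: small; rewrite psiG oG; move: (psi C) #|C| => *; lia.
have p3C: 3.-group C.
  have odC: ~~ (2 %| #|C|).
    apply/negP=> d2C; have := psi_abelian_even abC d2C d3C.
    by move: (psi C) #|C| smallC c3 => *; lia.
  apply/pgroupP=> q pr_q dq; rewrite inE; have := pi23 q.
  rewrite mem_primes pr_q cardG_gt0 (dvdn_trans dq) ?cardSg // => /(_ isT).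
  by case: q pr_q dq => [|[|[|[|]]]] // _ d2C; rewrite d2C in odC.
have elC: 3.-abelem C.
  have [//|/(psi_not_abelem3 abC p3C)] := boolP (3.-abelem C).
  by move: smallC c3; move: (psi C) #|C| => *; lia.
exists t; split=> //; have := psi_abelem3 elC; rewrite psiG.
by move: (psi C) #|C| => *; lia.
Qed.

(** An element of K fixed by t is equal to its inverse, hence trivial as |K| is
    odd. *)
Lemma frobenius_of_inversion (gT : finGroupType) (G K : {group gT}) (t : gT) :
    K \subset G -> #|G| = (2 * #|K|)%N -> odd #|K| -> K :!=: 1 ->
    t \in G :\: K -> #[t] = 2 -> {in K, forall y, y ^ t = y^-1} ->
  [Frobenius G = K ><| <[t]>].
Proof.
move=> sKG oG oddK K1 /setDP[Gt nKt] ot inv.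
have t1 : t != 1 by rewrite -order_gt1 ot.
have coKt : coprime #|K| #|<[t]>|.
  by rewrite -[#|<[t]>|]/#[t] ot coprimen2.
have nKT : <[t]> \subset 'N(K).
  rewrite cycle_subG; apply/normP/eqP; rewrite eqEcard cardJg leqnn andbT.
  by apply/subsetP=> _ /imsetP[y Ky ->]; rewrite inv // groupV.
have defG : K ><| <[t]> = G.
  rewrite sdprodE ?coprime_TIg //; apply/eqP.
  rewrite eqEcard mul_subG ?cycle_subG //= coprime_cardMg //.
  by rewrite -[#|<[t]>|]/#[t] ot mulnC oG.
apply/(Frobenius_semiregularP defG K1).
  by rewrite cycle_eq1.
move=> u /setD1P[u1 /cyclePmin[k]]; rewrite ot.
case: k => [|[|k]] // _ uE; first by rewrite uE expg0 eqxx in u1.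
rewrite uE expg1; apply/trivgP/subsetP=> y /setIP[Ky cty]; rewrite inE.
have yt : y ^ t = y by apply/eqP; rewrite -mem_cent1J cent1C.
have y2 : #[y] %| 2.
  by rewrite order_dvdn expgS expg1 -{1}yt (inv y Ky) mulVg.
have oy : odd #[y] := dvdn_odd (order_dvdG Ky) oddK.
by rewrite -order_eq1; move: #[y] y2 oy => -[|[|[|n]]].
Qed.

(** * The index of the centralizer *)

(** The normaliser of <x> lies between 'C_G[x] and G with both indices equal to 2,
    and a subgroup of index 2 contains all elements of odd order. *)
Lemma order3_in_centralizer (gT : finGroupType) (G : {group gT}) (x : gT) :
    x \in G -> #[x] = 3 -> inverters G x != set0 -> #|G : 'C_G[x]| = 4 ->
  (#|[set g in G | #[g] == 3]| < #|'C_G[x]|)%N.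
Proof.
move=> Gx ox I0 iC; have oN := card_inverters_normaliser Gx ox I0.
set N := 'N_G(<[x]>) in oN.
have sNG: N \subset G := subsetIl _ _.
have sCG: 'C_G[x] \subset G := subsetIl _ _.
have sCN: 'C_G[x] \subset N by rewrite setIS // -cent_cycle cent_sub.
have c0 := cardG_gt0 'C_G[x].
have iNC : #|N : 'C_G[x]| = 2.
  by apply/eqP; rewrite -(eqn_pmul2l c0) Lagrange // oN mulnC.
have iGN : #|G : N| = 2.
  have := Lagrange_index sNG sCN; rewrite iC iNC.
  by move: #|G : N| => *; lia.
apply: (@leq_ltn_trans #|'C_G[x] :\ 1|); last by rewrite [ltnRHS](cardsD1 1) group1.
apply: subset_leq_card; apply/subsetP=> g /setIdP[Gg /eqP og].
rewrite in_setD1 -order_gt1 og /=.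
have od: odd #[g] by rewrite og.
by apply: (odd_order_index2 sCN iNC) => //; apply: (odd_order_index2 sNG iGN).
Qed.

(** Subgroups of order 3 are Sylow subgroups, hence conjugate to <x>, and x is
    conjugate to its inverse. *)
Lemma order3_conjugate (gT : finGroupType) (G : {group gT}) (x : gT) :
    x \in G -> #[x] = 3 -> inverters G x != set0 -> #|G| = 24 ->
  [set g in G | #[g] == 3] \subset x ^: G.
Proof.
move=> Gx ox I0 oG; have syl g : g \in G -> #[g] = 3 -> 3.-Sylow(G) <[g]>.
  by move=> Gg og; rewrite pHallE cycle_subG Gg oG -[#|_|]/#[g] og p_part.
apply/subsetP=> g /setIdP[Gg /eqP og].
have [u Gu] := Sylow_trans (syl x Gx ox) (syl g Gg og).
move=> gE; have : g \in <[x]> :^ u by rewrite -gE cycle_id.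
case/imsetP=> z Xz gz; have oz: #[z] = 3 by rewrite -og gz orderJ.
rewrite gz; case: (cycle3_nontrivial ox Xz oz) => /eqP->.
  exact: memJ_class.
have [t /setIdP[Gt /eqP xt]] := set0Pn _ I0.
by rewrite -xt -conjgM; apply: memJ_class; rewrite groupM.
Qed.

(** Put n = |G|, c = |C| and h = n/c for the centralizer C of x; c is a multiple
    of 3. If nothing inverts x, then n + 4c < 24, so c = 3 and h <= 2. Otherwise h
    is even, as the normaliser of <x> has order 2c, and n < 4c + 24 bounds h by
    11, leaving 2, 4, 8 and 10. Since 5 does not divide n, h is not 10. For
    h = 4 and h = 8 the weights with e = 1 require more elements of order 3
    than there are. *)
Lemma index_cent_order3 (gT : finGroupType) (G : {group gT}) (x : gT) :
    (12 * psi G < 31 * #|G|)%N -> x \in G -> #[x] = 3 ->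
    ~~ (3 %| #|G : 'C_G[x]|) ->
  #|G| = 3 \/ #|G : 'C_G[x]| = 2.
Proof.
move=> small Gx ox n3h; have sCG: 'C_G[x] \subset G := subsetIl _ _.
have d3C: 3 %| #|'C_G[x]| by rewrite -ox order_dvdG // inE Gx cent1id.
have [k ck] := dvdnP d3C; have c0 := cardG_gt0 'C_G[x].
have nE := Lagrange sCG; have h0 : (0 < #|G : 'C_G[x]|)%N := indexg_gt0 _ _.
have w0 := order3_coset_bound (leq0n 1) Gx ox.
have w1 := order3_coset_bound (leqnn 1) Gx ox.
have [i0|ic] := card_inverters G x.
  move: w0; rewrite i0.
  move: (psi G) #|G| #|'C_G[x]| #|G : 'C_G[x]| nE ck c0 h0 n3h small.
  move=> s n c h nE ck c0 h0 n3h small w0.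
  have {w0} lt24 : (n + 4 * c < 24)%N by lia.
  have k1 : k = 1%N by nia.
  have h4 : (h < 4)%N by lia.
  by case: h h4 h0 n3h nE => [|[|[|[|h]]]] // _ _ _ nE; [left|right]; lia.
have I0 : inverters G x != set0 by rewrite -card_gt0 ic.
have ev : 2 %| #|G : 'C_G[x]|.
  have := cardSg (subsetIl G 'N(<[x]>)).
  rewrite (card_inverters_normaliser Gx ox I0) -nE mulnC.
  by rewrite dvdn_pmul2l.
have pi5 := pi_le3_of_small_psi small (x := 5).
have h4 := order3_in_centralizer Gx ox I0.
have h8 : #|G : 'C_G[x]| = 8 -> #|'C_G[x]| = 3 ->
    (#|[set g in G | #[g] == 3]| <= 8)%N.
  move=> iC cC; rewrite -iC index_cent1; apply: subset_leq_card.
  by apply: order3_conjugate => //; rewrite -nE iC cC.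
move: pi5 w0 w1; rewrite mem_primes cardG_gt0 ic /=.
move: #|[set g in G | _]| h4 h8 => n3 h4 h8.
move: (psi G) #|G| #|'C_G[x]| #|G : 'C_G[x]| nE ck c0 h0 n3h ev small h4 h8.
move=> s n c h nE ck c0 h0 n3h ev small h4 h8 pi5 w0 w1.
have {w0} lt24 : (n < 4 * c + 24)%N by lia.
have {w1} n3_big : (9 * n < 12 * n3 + 8 * c + 36)%N by lia.
have h12 : (h < 12)%N by nia.
case: (ltngtP h 4) => h4'; last by have := h4 h4'; lia.
  by right; case: h h4' h0 ev {n3h nE h4 h8 pi5 h12} => [|[|[|[|]]]].
have [h10|h8'] : h = 10 \/ h = 8.
- move: h h4' h12 ev n3h {nE h4 h8 pi5 h0}.
  by do 12?[case=> //]; [right|left].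
  by move: pi5; rewrite -nE h10 dvdn_mull // => /(_ isT).
(* 8c < 4c + 24 with c a multiple of 3. *)
have c3 : c = 3 by lia.
by have := h8 h8' c3; lia.
Qed.

Lemma order_sum_cases (gT : finGroupType) (G : {group gT}) :
    (12 * psi G < 31 * #|G|)%N -> ~~ 2.-group G ->
  #|G| = 3 \/ exists x t, [/\ x \in G, t \in G :\: 'C_G[x],
     #|G : 'C_G[x]| = 2, #[t] = 2 & [/\ 3.-abelem 'C_G[x], x \in 'C_G[x]^#,
    {in 'C_G[x], forall y, y ^ t = y^-1}
    & (psi G + 2 = 5 * #|'C_G[x]|)%N]].
Proof.
move=> small np2; have d3 : 3 %| #|G|.
  apply: contraR np2 => n3; apply/pgroupP=> q pr_q dq; rewrite inE.
  have := pi_le3_of_small_psi small (x := q).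
  rewrite mem_primes pr_q cardG_gt0 dq => /(_ isT).
  by case: q pr_q dq => [|[|[|[|]]]] // _ d3; rewrite d3 in n3.
have [P sylP] := Sylow_exists 3 G; have [sPG p3P _] := and3P sylP.
have P1 : P :!=: 1.
  rewrite -cardG_gt1 (card_Hall sylP) p_part_gt1 mem_primes /= cardG_gt0 //.
have Z1 : 'Z(P) != 1.
  by rewrite (center_nil_eq1 (pgroup_nil p3P)).
have dZ : 3 %| #|'Z(P)|.
  have pZ : 3.-group 'Z(P) := pgroupS (center_sub P) p3P.
  by have [] := pgroup_pdiv pZ Z1.
(* Centrality of x in P makes the index of its centralizer prime to 3. *)
have [x /setIP[Px cPx] ox] := Cauchy (isT : prime 3) dZ.
have Gx : x \in G := subsetP sPG x Px.
have n3h : ~~ (3 %| #|G : 'C_G[x]|).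
  have sPC : P \subset 'C_G[x] by rewrite subsetI sPG sub_cent1.
  have [_ _ p'GP] := and3P sylP.
  by rewrite -p'natE // (pnat_dvd (indexgS G sPC)).
have [oG|iC] := index_cent_order3 small Gx ox n3h; first by left.
right; exists x; have [t [Dt ot elC inv psiG]] :=
  centralizer_index2 (pi_le3_of_small_psi small) Gx ox iC small.
exists t; split=> //; split=> //.
by rewrite in_setD1 -order_gt1 ox inE Gx cent1id.
Qed.

(** * Two-groups *)

(** Orders in a 2-group are 1, 2 or at least 4. *)
Lemma psi_two_group_ge (gT : finGroupType) (G : {group gT}) :
  2.-group G -> (4 * #|G| <= psi G + 2 * n2 G + 3)%N.
Proof.
move=> p2G; have pt g : g \in G ->
    (4 <= #[g] + (g \in [set g in G | #[g] == 2]) * 2 + (g == 1%g) * 3)%N.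
  move=> Gg; rewrite inE Gg; have [->|g1] := eqVneq g 1; first by rewrite order1.
  have [k ok] := p_natP (mem_p_elt p2G Gg); move: g1; rewrite -order_eq1 ok.
  case: k {ok} => [|[|k]] // _.
  by rewrite !expnS; have := expn_gt0 2 k; lia.
have := leq_sum (index_enum gT) pt.
rewrite !big_split -!big_distrl /= sum_eq1 sum_mem_subset; last first.
  by apply/subsetP=> g /setIdP[].
rewrite sum_nat_const -/(psi G) -/(n2 G).
by move: (psi G) (n2 G) #|G| => *; lia.
Qed.

(** The involutions and 1 lie in Ohm_1(G), which therefore has more than half of the
    elements of G and equals G. Thus the abelian group G/G' is generated by
    elements of order at most 2, so it is elementary abelian and Phi(G) lies in
    G'. *)
Lemma Phi_der1_two_group (gT : finGroupType) (G : {group gT}) :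
  2.-group G -> (17 * #|G| < 24 * n2 G + 36)%N -> G^`(1) = 'Phi(G).
Proof.
move=> p2G big.
have sI : 1 |: [set g in G | #[g] == 2] \subset 'Ohm_1(G).
  rewrite subUset sub1G (OhmE 1 p2G); apply/subset_trans/subset_gen.
  apply/subsetP=> g /setIdP[Gg /eqP og].
  by rewrite !inE Gg expn1 -og expg_order eqxx.
have leO: (n2 G + 1 <= #|'Ohm_1(G)|)%N.
  have := subset_leq_card sI; rewrite cardsU1 inE order1 andbF.
  by rewrite addnC -/(n2 G).
have OhmG: 'Ohm_1(G) = G.
  apply/eqP; rewrite eqEproper Ohm_sub /=; apply/negP=> ltO.
  have := proper_subgroup_half ltO.
  (* For |G| = 2 the count of involutions alone would allow Ohm_1(G) = 1. *)
  have O1: (1 < #|'Ohm_1(G)|)%N.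
    rewrite cardG_gt1; apply: contraTneq ltO => O1.
    have /eqP G1: G :==: 1 by rewrite -Ohm1_eq1 O1.
    by rewrite O1 {1}G1 properxx.
  by move: (n2 G) #|'Ohm_1(G)| #|G| big leO O1 => *; lia.
apply/eqP; rewrite eqEsubset; apply/andP; split.
  by rewrite (Phi_joing p2G) joing_subl.
apply: (Phi_min p2G (der_norm 1 G)).
have abQ : abelian (G / G^`(1)) := sub_der1_abelian (subxx _).
apply/(abelem_Ohm1P abQ (quotient_pgroup _ p2G))/eqP.
rewrite eqEsubset Ohm_sub /=.
by have := morphim_Ohm 1 (coset_morphism G^`(1)) (der_norm 1 G); rewrite OhmG.
Qed.

End OrderSums.

Local Open Scope ring_scope.

Theorem theorem1p2 (gT : finGroupType) (G : {group gT})
    (hG : avg_order G < 31 / 12) :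
  [\/ [/\ (2.-group G)%g,
          (G^`(1) = 'Phi(G) :> {set gT})%g
        & (n2 G)%:R > 17 / 24 * #|G|%:R - 3 / 2 :> rat],
      (G \isog Zp 3)%g
    | exists (K H : {group gT}) (m : nat),
        [/\ [Frobenius G = K ><| H]%g,
            (3.-abelem K)%g,
            (cyclic H)%g /\ #|H| = 2%N,
            #|K| = (3 ^ m)%N
          & avg_order G = (5 * 3 ^+ m - 2) / (2 * 3 ^+ m)]].
Proof.
have n_gt0 : 0 < #|G|%:R :> rat by rewrite ltr0n cardG_gt0.
have small : (12 * psi G < 31 * #|G|)%N.
  move: hG; rewrite /avg_order ltr_pdivrMr // mulrAC ltr_pdivlMr ?ltr0n //.
  by rewrite -!natrM ltr_nat mulnC.
have [p2G|np2G] := boolP (2.-group G)%g.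
  have big : (17 * #|G| < 24 * n2 G + 36)%N.
    have := psi_two_group_ge p2G.
    by move: (psi G) (n2 G) #|G| small => *; lia.
  constructor 1; split=> //; first exact: Phi_der1_two_group.
  have : (17 * #|G|)%:R < (24 * n2 G + 36)%:R :> rat by rewrite ltr_nat.
  by rewrite natrD !natrM; lra.
have [oG|[x [t [Gx Dt iC ot [elC Cx inv psiG]]]]] := order_sum_cases small np2G.
  constructor 2.
  have cycG : cyclic G by apply: prime_cyclic; rewrite oG.
  by rewrite (isog_cyclic_card _ cycG) oG prime_cyclic card_Zp.
constructor 3; exists 'C_G[x]%G, <[t]>%G; have [p3C _] := andP elC.
have [m oC] := p_natP p3C; exists m.
have oG : #|G| = (2 * #|'C_G[x]%g|)%N.
  by rewrite -(Lagrange (subsetIl G 'C[x]%g)) iC mulnC.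
split=> //.
- apply: frobenius_of_inversion Dt ot inv; rewrite ?subsetIl //.
    by rewrite oC oddX orbT.
  by apply/trivgPn; exists x; case/setD1P: Cx.
- by split; [apply: cycle_cyclic | exact: ot].
have -> : avg_order G = (5 * #|'C_G[x]%g|%:R - 2) / (2 * #|'C_G[x]%g|%:R).
  rewrite /avg_order oG natrM; congr (_ / _).
  by rewrite -natrM -psiG natrD addrK.
by rewrite oC natrX.
Qed.
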